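(* Let $d\ge 2$ and let $A_1(\gamma),\dots,A_d(\gamma)$ be (not necessarily independent) events indexed by $\gamma\in\mathbb{R}$, with $A(\gamma)=\bigcup_{i=1}^d A_i(\gamma)$, $\alpha(\gamma)=\mathbb{P}(A(\gamma))>0$ and $\alpha(\gamma)\to 0$ as $\gamma\to\infty$. Let $E(\gamma)=\sum_{i=1}^d \mathbf{1}\{A_i(\gamma)\}$ and consider the estimator of $\alpha(\gamma)$ $$\hat\alpha_1(\gamma)=\sum_{i=1}^d\mathbb{P}(A_i(\gamma))+(1-E(\gamma))\,\mathbf{1}\{E(\gamma)\ge 2\}.$$ Then $\hat\alpha_1$ has logarithmic efficiency if and only if for all $\epsilon>0$ $$\limsup_{\gamma\to\infty}\frac{\max_{i<j}\mathbb{P}(A_i(\gamma)\cap A_j(\gamma))}{\big(\max_{k}\mathbb{P}(A_k(\gamma))\big)^{2-\epsilon}}=0,$$ and $\hat\alpha_1$ has bounded relative error if and only if $$\limsup_{\gamma\to\infty}\frac{\max_{i<j}\mathbb{P}(A_i(\gamma)\cap A_j(\gamma))}{\big(\max_{k}\mathbb{P}(A_k(\gamma))\big)^{2}}<\infty.$$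
   Context: Here $\mathbf{1}\{\cdot\}$ denotes the indicator function, and the dimension $d$ does not depend on $\gamma$. An estimator $\hat p_\gamma$ of a rare probability $p_\gamma$ (with $p_\gamma\to0$ as $\gamma\to\infty$) has logarithmic efficiency if for all $\epsilon>0$, $\limsup_{\gamma\to\infty}\operatorname{Var}(\hat p_\gamma)/p_\gamma^{2-\epsilon}=0$; it has bounded relative error if $\limsup_{\gamma\to\infty}\operatorname{Var}(\hat p_\gamma)/p_\gamma^{2}<\infty$. *)

(* Defs.v *)
From mathcomp Require Export all_boot all_order all_algebra.
From mathcomp Require Export all_classical all_reals all_analysis.

Set Implicit Arguments.
Unset Strict Implicit.
Unset Printing Implicit Defensive.

Export Order.TTheory GRing.Theory Num.Theory.
Export numFieldNormedType.Exports.

#[global] Open Scope classical_set_scope.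
#[global] Open Scope ring_scope.
#[global] Open Scope ereal_scope.

(* Limit superior as the real parameter tends to infinity, computed in \bar R. *)
Definition limsup_pinfty (R : realType) (f : R -> \bar R) : \bar R :=
  limf_esup f (pinfty_nbhs R).

(* Probabilities are kept in \bar R, the codomain of P.  Division in \bar R
   agrees with real division when the denominator is positive and finite, the
   only case that arises when [p g] is a nonzero probability. *)
Definition logarithmic_efficiency (disp : measure_display)
    (T : measurableType disp) (R : realType) (P : probability T R)
    (phat : R -> T -> R) (p : R -> \bar R) : Prop :=
  forall e : R, (0 < e)%R ->
    limsup_pinfty (fun g => 'V_P[phat g] / (p g `^ (2 - e))) = 0.

Definition bounded_relative_error (disp : measure_display)
    (T : measurableType disp) (R : realType) (P : probability T R)
    (phat : R -> T -> R) (p : R -> \bar R) : Prop :=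
  limsup_pinfty (fun g => 'V_P[phat g] / (p g ^+ 2)) < +oo.

Definition event_count (T : Type) (R : realType) (d : nat)
    (A : 'I_d -> R -> set T) (g : R) (w : T) : R :=
  (\sum_(i < d) \1_(A i g) w)%R.

Definition alpha (disp : measure_display) (T : measurableType disp)
    (R : realType) (P : probability T R) (d : nat)
    (A : 'I_d -> R -> set T) (g : R) : \bar R :=
  P (\bigcup_i A i g).

Definition alphahat1 (disp : measure_display) (T : measurableType disp)
    (R : realType) (P : probability T R) (d : nat)
    (A : 'I_d -> R -> set T) (g : R) (w : T) : R :=
  (\sum_(i < d) fine (P (A i g)) +
   (1 - event_count A g w) * \1_[set w' | 2 <= event_count A g w'] w)%R.

(* The neutral element -oo is never attained by the two maxima below as soon as
   their index ranges are nonempty, i.e. when 0 < d, resp. 1 < d. *)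
Definition max_prob (disp : measure_display) (T : measurableType disp)
    (R : realType) (P : probability T R) (d : nat)
    (A : 'I_d -> R -> set T) (g : R) : \bar R :=
  \big[maxe/-oo]_(k < d) P (A k g).

Definition max_pair_prob (disp : measure_display) (T : measurableType disp)
    (R : realType) (P : probability T R) (d : nat)
    (A : 'I_d -> R -> set T) (g : R) : \bar R :=
  \big[maxe/-oo]_(ij : 'I_d * 'I_d | (ij.1 < ij.2)%N)
    P (A ij.1 g `&` A ij.2 g).

(* Main.v *)
(** Up to sign and an additive constant, the estimator is
    [Y = (E - 1) * 1{E >= 2}].  As [1{E >= 2} <= Y <= d * 1{E >= 2}], writing
    [q = P(E >= 2)], its variance is squeezed between [q - (d * q)^2] and
    [d^2 * q].  Since [q <= alpha -> 0], the variance is eventually comparable,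
    up to constants depending only on [d], to [q], hence to
    [max_(i < j) P(A_i `&` A_j)] by the union bound.  Likewise
    [max_k P(A_k) <= alpha <= d * max_k P(A_k)].  So both ratios in each
    equivalence dominate each other up to a constant factor. *)

Require Import Defs.
From mathcomp Require Import measurable_realfun lra.

Set Implicit Arguments.
Unset Strict Implicit.
Unset Printing Implicit Defensive.

(** * Second moments and union bounds on a probability space *)

Lemma bounded_Lfun2 (disp : measure_display) (T : measurableType disp)
    (R : realType) (P : probability T R) (c : R) (Y : T -> R) :
  measurable_fun setT Y -> (forall x, `|Y x| <= c)%R -> Y \in Lfun P 2%:E.
Proof.
move=> mY Yc; apply/andP; split; rewrite inE//= /finite_norm unlock /Lnorm.
rewrite poweR_lty// (@le_lt_trans _ _ (\int[P]_x (c `^ 2)%:E)) //.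
  apply: ge0_le_integral => //=.
  - apply/measurable_EFinP.
    apply: (@measurableT_comp _ _ _ _ _ _ (@powR R ^~ 2%R)) => //.
    exact: measurableT_comp.
  - move=> x _; rewrite lee_fin ge0_ler_powR// nnegrE//.
    exact: le_trans (Yc x).
rewrite integral_cst// -ge0_fin_numE ?mule_ge0 ?lee_fin ?powR_ge0//.
by rewrite fin_numM// fin_num_measure.
Qed.

(** The sandwich forces [0 <= Y], so it survives squaring: [E[Y^2]] lies between [P B] and
    [c^2 * P B], while [0 <= E[Y] <= c * P B]. Both bounds then follow from [Var Y = E[Y^2] -
    E[Y]^2]. *)
Lemma variance_indic_bounds (disp : measure_display) (T : measurableType disp)
    (R : realType) (P : probability T R) (B : set T) (c : R) (Y : T -> R) :
  measurable B -> measurable_fun setT Y ->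
  (forall x, \1_B x <= Y x <= c * \1_B x)%R ->
  P B - ((c * fine (P B)) ^+ 2)%:E <= 'V_P[Y] <= (c ^+ 2)%:E * P B.
Proof.
move=> mB mY Yb.
have Y0 x : (0 <= Y x)%R.
  by have /andP[+ _] := Yb x; apply: le_trans; rewrite indicE.
have Yc x : (`|Y x| <= `|c|)%R.
  have /andP[_ Yx] := Yb x; rewrite ger0_norm//; apply: (le_trans Yx).
  rewrite indicE; case: (x \in B); rewrite ?mulr1 ?mulr0//; exact: ler_norm.
have Y2 : Y \in Lfun P 2%:E by exact: (bounded_Lfun2 P mY Yc).
have Y1 : Y \in Lfun P 1 by apply: Lfun_subset12 => //; exact: fin_num_measure.
have m1 : measurable_fun setT (\1_B : T -> R) by exact: measurable_indic.
have I1 : (\1_B : T -> R) \in Lfun P 1.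
  apply: Lfun_subset12; first exact: fin_num_measure.
  apply: (@bounded_Lfun2 _ _ _ _ 1) => // x.
  by rewrite indicE; case: (x \in B); rewrite /= ?normr1 ?normr0.
have EZ (k : R) : 'E_P[k \o* \1_B] = k%:E * P B.
  by rewrite expectationZl// expectation_indic.
have mZ (k : R) : measurable_fun setT (k \o* \1_B)%R.
  by apply: measurable_funM => //; exact: measurable_cst.
have EY : 'E_P[Y] <= c%:E * P B.
  rewrite -EZ; apply: expectation_le => //.
    move=> x; apply: le_trans (Y0 x) _; have /andP[_] := Yb x.
    by rewrite /= mulrC.
  by apply: nearW => x; have /andP[_] := Yb x; rewrite /= mulrC.
have mY2 : measurable_fun setT (Y ^+ 2)%R.
  by rewrite exprfctE; exact: measurable_funX.
have Y20 x : (0 <= (Y ^+ 2) x)%R by rewrite fctE exprn_ge0.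
have EY2l : P B <= 'E_P[Y ^+ 2].
  rewrite -expectation_indic//; apply: expectation_le => //.
  apply: nearW => x; rewrite fctE; have /andP[+ _] := Yb x.
  by rewrite indicE; case: (x \in B) => /= h; nra.
have EY2u : 'E_P[Y ^+ 2] <= (c ^+ 2)%:E * P B.
  rewrite -EZ; apply: expectation_le => //.
    by move=> x /=; rewrite mulr_ge0 ?sqr_ge0// indicE.
  apply: nearW => x; rewrite fctE/=; have /andP[_] := Yb x; have := Y0 x.
  by rewrite indicE; case: (x \in B) => /= h h'; nra.
have fB : P B \is a fin_num by exact: fin_num_measure.
have E0 : 0 <= 'E_P[Y] by exact: expectation_ge0.
have fE := expectation_fin_num Y1.
rewrite varianceE//; apply/andP; split.
  apply: leeB => //; rewrite -(fineK fE) -EFin_expe lee_fin.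
  rewrite ler_sqr ?nnegrE ?fine_ge0//.
    by rewrite -lee_fin EFinM !fineK.
  have := le_trans E0 EY.
  by rewrite -{1}(fineK fB) -EFinM lee_fin.
apply: le_trans EY2u; rewrite geeDl// oppe_le0.
by rewrite -(fineK fE) -EFin_expe lee_fin sqr_ge0.
Qed.

Lemma le_measure_cover (disp : measure_display) (T : measurableType disp)
    (R : realType) (P : probability T R) (I : finType) (F : I -> set T)
    (B : set T) (m : \bar R) :
  measurable B -> (forall i, measurable (F i)) -> B `<=` \bigcup_i F i ->
  (forall i, P (F i) <= m) -> P B <= #|I|%:R%:E * m.
Proof.
move=> mB mF BF Fm.
apply: (le_trans (@content_sub_fsum _ _ _ P _ setT B F finite_finset _ mB BF)).
  by move=> i _.
(* The sum over [setT] becomes one over the duplicate-free list [enum I], whose length supplies the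
   factor [#|I|]. *)
rewrite (@fsbig_fwiden _ _ _ _ (enum I)) ?enum_uniq//; last 2 first.
- by move=> i _ /=; rewrite mem_enum.
- by move=> i [_ /(_ Logic.I)].
rewrite big_enum/= (le_trans (lee_sum _ (fun i _ => Fm i)))//.
by rewrite sumr_const cardT -cardE mule_natl.
Qed.

(** * Domination up to a constant factor: limits superior, powers, quotients *)

Lemma limsup_pinfty_le (R : realType) (k : R) (f g : R -> \bar R) :
  (0 < k)%R -> (\forall x \near +oo%R, f x <= k%:E * g x) ->
  limsup_pinfty f <= k%:E * limsup_pinfty g.
Proof.
move=> k0 fg; rewrite -lee_pdivrMl//; apply: le_ereal_inf_tmp => _ [V FV <-].
rewrite lee_pdivrMl//.
(* The limsup is an infimum of suprema over neighbourhoods of infinity; shrinking [V] to the points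
   where the domination holds keeps it a neighbourhood. *)
apply: (@le_trans _ _ (ereal_sup (f @` (V `&` [set x | f x <= k%:E * g x])))).
  by apply: ereal_inf_lbound; exists (V `&` [set x | f x <= k%:E * g x]) => //;
    exact: filterI.
apply: ge_ereal_sup => _ [x [Vx fgx] <-]; apply: (le_trans fgx).
by rewrite lee_pmul2l//; apply: ereal_sup_ubound; exists x.
Qed.

Lemma limsup_pinfty_ge0 (R : realType) (f : R -> \bar R) :
  (forall x, 0 <= f x) -> 0 <= limsup_pinfty f.
Proof. by apply: limf_esup_ge0; exact: filter_not_empty. Qed.

Lemma limsup_pinfty_eq0 (R : realType) (k : R) (f g : R -> \bar R) :
  (0 < k)%R -> (forall x, 0 <= f x) ->
  (\forall x \near +oo%R, f x <= k%:E * g x) ->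
  limsup_pinfty g = 0 -> limsup_pinfty f = 0.
Proof.
move=> k0 f0 /(limsup_pinfty_le k0) + g0; rewrite g0 mule0 => fle0.
by apply/eqP; rewrite eq_le fle0 limsup_pinfty_ge0.
Qed.

Lemma limsup_pinfty_lty (R : realType) (k : R) (f g : R -> \bar R) :
  (0 < k)%R -> (\forall x \near +oo%R, f x <= k%:E * g x) ->
  limsup_pinfty g < +oo -> limsup_pinfty f < +oo.
Proof.
move=> k0 /(limsup_pinfty_le k0)/le_lt_trans + goo; apply.
by rewrite lte_mul_pinfty// ?lee_fin ?ltW.
Qed.

(** For [0 <= s] the power is monotone and [b <= k * a] is what matters; for [s < 0] it is antitone
    and [a <= k * b] takes over. Negative exponents do occur, as [2 - e] with [2 < e]; the absolute
    value gives one constant for both signs. *)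
Lemma powR_comparable (R : realType) (a b k s : R) :
  (0 < a -> 0 < b -> 0 < k -> a <= k * b -> b <= k * a ->
   b `^ s <= k `^ `|s| * a `^ s)%R.
Proof.
move=> a0 b0 k0 ab ba.
have [a0' b0' k0'] := And3 (ltW a0) (ltW b0) (ltW k0).
have [ka0 kb0] := (mulr_ge0 k0' a0', mulr_ge0 k0' b0').
have [s0|s0] := leP 0%R s.
  by rewrite ger0_norm// -powRM// ge0_ler_powR// nnegrE.
rewrite ltr0_norm// -{1 3}[s]opprK powRN (powRN a).
rewrite ler_pdivlMr ?powR_gt0// mulrC ler_pdivrMr ?powR_gt0//.
by rewrite -powRM// ge0_ler_powR ?nnegrE// oppr_ge0 ltW.
Qed.

(** The numerators cost a factor [k], the denominators a factor [k] to the power [|s|]. *)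
Lemma le_div_poweR (R : realType) (k s : R) (x y a b : \bar R) :
  (0 < k)%R -> 0 <= x -> x <= k%:E * y ->
  0 < a -> a < +oo -> 0 < b -> b < +oo -> a <= k%:E * b -> b <= k%:E * a ->
  x / (a `^ s) <= (k * k `^ `|s|)%:E * (y / (b `^ s)).
Proof.
move=> k0 x0 xy; case: a => [a| |]//; case: b => [b| |]//.
rewrite !lte_fin => a0 _ b0 _; rewrite -!EFinM !lee_fin => ab ba.
rewrite !poweR_EFin !inver !gt_eqF ?powR_gt0// EFinM muleACA.
rewrite lee_pmul// ?lee_fin ?invr_ge0 ?powR_ge0//.
rewrite ler_pdivlMr ?powR_gt0// mulrC ler_pdivrMr ?powR_gt0//.
exact: powR_comparable.
Qed.

Lemma expe2_poweR (R : realType) (x : \bar R) :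
  0 <= x -> x < +oo -> x ^+ 2 = x `^ 2.
Proof.
case: x => [x| |]// x0 _.
by rewrite poweR_EFin powR_mulrn -?lee_fin// EFin_expe.
Qed.

(** * Counting the events that occur *)

Lemma event_countE (T : Type) (R : realType) (d : nat) (A : 'I_d -> R -> set T)
    (g : R) (w : T) :
  event_count A g w = #|[pred i | w \in A i g]|%:R%R.
Proof.
rewrite /event_count; under eq_bigr do rewrite indicE.
by rewrite -natr_sum -sum1_card [in RHS]big_mkcond.
Qed.

(** A count of at least two yields two distinct indices, which can be listed in increasing order. *)
Lemma event_count_ge2E (T : Type) (R : realType) (d : nat)
    (A : 'I_d -> R -> set T) (g : R) :
  [set w | 2 <= event_count A g w]%R =
  \bigcup_(ij in [set ij : 'I_d * 'I_d | (ij.1 < ij.2)%N])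
    (A ij.1 g `&` A ij.2 g).
Proof.
apply/seteqP; split => w /=; rewrite event_countE ler_nat.
  move=> /card_gt1P[i [j []]]; rewrite !inE => Ai Aj.
  by rewrite neq_ltn => /orP[] ij; [exists (i, j)|exists (j, i)].
move=> [[i j] /= ij [Ai Aj]]; apply/card_gt1P; exists i, j.
by rewrite !inE neq_ltn ij.
Qed.

(** * Bounds at a fixed value of the parameter *)

Section fixed_parameter.
Variables (disp : measure_display) (T : measurableType disp) (R : realType).
Variables (P : probability T R) (d : nat) (A : 'I_d -> R -> set T) (g : R).
Hypothesis mA : forall i, measurable (A i g).

Let B := [set w | 2 <= event_count A g w]%R.

Lemma measurable_event_count : measurable_fun setT (event_count A g).
Proof. by apply: measurable_sum => i; exact: measurable_indic. Qed.

Lemma measurable_event_count_ge2 : measurable B.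
Proof.
rewrite /B event_count_ge2E; apply: fin_bigcup_measurable => //.
by move=> ij _; exact: measurableI.
Qed.

Lemma variance_alphahat1_bounds :
  P B - ((d%:R * fine (P B)) ^+ 2)%:E <= 'V_P[alphahat1 P A g]
    <= (d%:R ^+ 2)%:E * P B.
Proof.
have mB := measurable_event_count_ge2.
pose Y w := ((event_count A g w - 1) * \1_B w)%R.
have mY : measurable_fun setT Y.
  apply: measurable_funM; last exact: measurable_indic.
  by apply: measurable_funB => //; exact: measurable_event_count.
have Yb w : (\1_B w <= Y w <= d%:R * \1_B w)%R.
  rewrite /Y indicE; have [|_] := boolP (w \in B); last by rewrite !mulr0 lexx.
  (* On [B], [E >= 2] gives [E - 1 >= 1], and [E - 1 <= E <= d]. *)
  rewrite inE /B /= => E2; rewrite !mulr1; apply/andP; split.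
    by rewrite lerBrDr (_ : 1 + 1 = 2)%R.
  apply: (@le_trans _ _ (event_count A g w)); first by rewrite gerDl oppr_le0.
  by rewrite event_countE ler_nat (leq_trans (max_card _))// card_ord.
have -> : alphahat1 P A g = (cst (\sum_(i < d) fine (P (A i g)))%R \- Y)%R.
  by apply/funext => w; rewrite /alphahat1 /= /Y -mulNr opprB.
rewrite varianceB_cst_l; first exact: variance_indic_bounds.
apply: (@bounded_Lfun2 _ _ _ _ d%:R%R) => // w; have /andP[Yl Yu] := Yb w.
have i0 : (0 <= \1_B w :> R)%R by rewrite indicE.
rewrite ger0_norm ?(le_trans i0)//; apply: (le_trans Yu).
by rewrite indicE; case: (w \in B); rewrite ?mulr1 ?mulr0.
Qed.

Lemma max_pair_prob_le : max_pair_prob P A g <= P B.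
Proof.
apply: bigmax_le => [|ij ij_lt]; first exact: leNye.
apply: le_measure; rewrite ?inE.
- exact: measurableI.
- exact: measurable_event_count_ge2.
- by rewrite /B event_count_ge2E => w Aw; exists ij.
Qed.

Lemma max_prob_le : max_prob P A g <= alpha P A g.
Proof.
apply: bigmax_le => [|i _]; first exact: leNye.
apply: le_measure; rewrite ?inE//.
- exact: fin_bigcup_measurable.
- by move=> w Aw; exists i.
Qed.

Lemma alpha_le : alpha P A g <= d%:R%:E * max_prob P A g.
Proof.
rewrite -[d in d%:R]card_ord.
apply: (@le_measure_cover _ _ _ _ _ (A ^~ g)) => //.
- exact: fin_bigcup_measurable.
- by move=> i; exact: (le_bigmax _ (fun i => P (A i g))).
Qed.

Hypothesis hd : (2 <= d)%N.

Lemma max_pair_prob_ge0 : 0 <= max_pair_prob P A g.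
Proof.
pose i0 := Ordinal (ltnW hd); pose i1 := Ordinal hd.
apply: (@le_trans _ _ (P (A i0 g `&` A i1 g))); first exact: measure_ge0.
exact: (@le_bigmax_cond _ _ _ _ (i0, i1) _
  (fun ij => P (A ij.1 g `&` A ij.2 g))).
Qed.

Lemma max_prob_ge0 : 0 <= max_prob P A g.
Proof.
apply: (@le_trans _ _ (P (A (Ordinal hd) g))); first exact: measure_ge0.
exact: (le_bigmax _ (fun i => P (A i g))).
Qed.

Lemma prob_event_count_ge2_le :
  P B <= (d%:R ^+ 2)%:E * max_pair_prob P A g.
Proof.
(* Padding with the empty set indexes the cover by all [d^2] pairs. The padded terms need the
   maximum to be nonnegative, which holds because [2 <= d] provides a pair. *)
pose F (ij : 'I_d * 'I_d) :=
  if (ij.1 < ij.2)%N then A ij.1 g `&` A ij.2 g else set0.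
have -> : (d%:R ^+ 2 = #|{: 'I_d * 'I_d}|%:R :> R)%R.
  by rewrite card_prod card_ord natrM.
apply: (@le_measure_cover _ _ _ _ _ F).
- exact: measurable_event_count_ge2.
- by move=> ij; rewrite /F; case: ifP => // _; exact: measurableI.
- rewrite /B event_count_ge2E => w [ij /= ij_lt Aw].
  by exists ij => //; rewrite /F ij_lt.
- move=> ij; rewrite /F; case: ifPn => ij_lt; last first.
    by rewrite measure0 max_pair_prob_ge0.
  exact: (le_bigmax_cond _ (fun ij => P (A ij.1 g `&` A ij.2 g))).
Qed.

End fixed_parameter.

(** One constant serves both directions: [d^4] is [d^2] from the variance bound times [d^2] from the
    union bound, and it also absorbs the factor 2 lost in the lower bound on the variance. *)
Lemma alphahat1_comparable (disp : measure_display) (T : measurableType disp)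
    (R : realType) (P : probability T R) (d : nat) (A : 'I_d -> R -> set T)
    (g : R) :
  (2 <= d)%N -> (forall i, measurable (A i g)) ->
  alpha P A g < (2 * d%:R ^+ 2)^-1%:E ->
  'V_P[alphahat1 P A g] <= (d%:R ^+ 4)%:E * max_pair_prob P A g /\
  max_pair_prob P A g <= (d%:R ^+ 4)%:E * 'V_P[alphahat1 P A g].
Proof.
move=> hd mA alpha_lt.
set B := [set w | 2 <= event_count A g w]%R.
have mB : measurable B by exact: measurable_event_count_ge2.
have d2 : (2 <= d%:R :> R)%R by rewrite ler_nat.
have d24 : (d%:R ^+ 4 = d%:R ^+ 2 * d%:R ^+ 2 :> R)%R by rewrite -exprD.
have dd4 : (4 <= d%:R ^+ 2 :> R)%R by nra.
have /andP[] := variance_alphahat1_bounds P mA; rewrite -/B => Vl Vu.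
split.
  apply: (le_trans Vu); rewrite d24 (@EFinM _ (_ ^+ 2) (_ ^+ 2)) -muleA.
  by rewrite lee_wpmul2l ?lee_fin ?sqr_ge0//; exact: prob_event_count_ge2_le.
apply: (le_trans (max_pair_prob_le P mA)); rewrite -/B.
have Ba : P B <= alpha P A g.
  apply: le_measure; rewrite ?inE//; first exact: fin_bigcup_measurable.
  by rewrite /B event_count_ge2E => w [ij _ [Ai _]]; exists ij.1.
have fB : P B \is a fin_num by exact: fin_num_measure.
have B0 : (0 <= fine (P B))%R by exact: fine_ge0.
have := le_lt_trans Ba alpha_lt; move: Vl; rewrite -(fineK fB) /=.
move: (fine (P B)) B0 => q q0 Vl; rewrite lte_fin => qlt.
(* The threshold on [alpha] is chosen for this: it gives [(d * q)^2 <= q / 2], so the variance keeps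
   at least [q / 2]. *)
have qd : (2 * d%:R ^+ 2 * q <= 1)%R.
  by rewrite mulrC -ler_pdivlMr ?div1r ?ltW//; lra.
have q2V : (q / 2)%:E <= 'V_P[alphahat1 P A g].
  by apply: le_trans Vl; rewrite -EFinB lee_fin; nra.
apply: (@le_trans _ _ ((d%:R ^+ 4)%:E * (q / 2)%:E)).
  have d42 : (2 <= d%:R ^+ 4 :> R)%R by rewrite d24; nra.
  by rewrite -EFinM lee_fin mulrA ler_pdivlMr// mulrC ler_wpM2r.
by rewrite lee_pmul2l// lte_fin exprn_gt0//; lra.
Qed.

Theorem proposition4 (disp : measure_display) (T : measurableType disp)
    (R : realType) (P : probability T R) (d : nat) (hd : (2 <= d)%N)
    (A : 'I_d -> R -> set T)
    (mA : forall (i : 'I_d) (g : R), measurable (A i g))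
    (alpha_gt0 : forall g : R, 0 < alpha P A g)
    (alpha_cvg0 : alpha P A g @[g --> +oo%R] --> 0) :
  (logarithmic_efficiency P (alphahat1 P A) (alpha P A) <->
     (forall e : R, (0 < e)%R ->
        limsup_pinfty (fun g =>
          max_pair_prob P A g / (max_prob P A g `^ (2 - e))) = 0))
  /\
  (bounded_relative_error P (alphahat1 P A) (alpha P A) <->
     limsup_pinfty (fun g => max_pair_prob P A g / (max_prob P A g ^+ 2))
       < +oo).
Proof.
(* Since [d <= d^4], this constant also compares [alpha] with [max_prob]. *)
pose k : R := (d%:R ^+ 4)%R.
have d2 : (2 <= d%:R :> R)%R by rewrite ler_nat.
have dk : (d%:R <= k)%R by rewrite /k -[leLHS]expr1 ler_weXn2l//; lra.
have k1 : (1 <= k)%R by lra.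
have k0 : (0 < k)%R by lra.
pose V g := 'V_P[alphahat1 P A g].
pose K (s : R) : R := (k * k `^ `|s|)%R.
have K0 s : (0 < K s)%R by rewrite mulr_gt0 ?powR_gt0.
have alpha_le_max g : alpha P A g <= k%:E * max_prob P A g.
  apply: (le_trans (alpha_le P (mA ^~ g))); rewrite lee_wpmul2r ?lee_fin//.
  exact: max_prob_ge0.
have max_le_alpha g : max_prob P A g <= k%:E * alpha P A g.
  apply: (le_trans (max_prob_le P (mA ^~ g))).
  by rewrite -[leLHS]mul1e lee_wpmul2r ?lee_fin// ltW.
have max_gt0 g : 0 < max_prob P A g.
  have := lt_le_trans (alpha_gt0 g) (alpha_le_max g).
  by rewrite pmule_rgt0.
have alpha_lty g : alpha P A g < +oo.
  by rewrite -ge0_fin_numE ?ltW//; apply: fin_num_measure;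
    exact: fin_bigcup_measurable.
have max_lty g : max_prob P A g < +oo.
  exact: le_lt_trans (max_prob_le P (mA ^~ g)) (alpha_lty g).
have alpha_small : \forall g \near +oo%R, alpha P A g < (2 * d%:R ^+ 2)^-1%:E.
  have /fine_cvgP[_ /cvgr_lt alpha_lt] := alpha_cvg0.
  have c0 : (0 < (2 * d%:R ^+ 2)^-1 :> R)%R by rewrite invr_gt0; nra.
  apply: filterS (alpha_lt _ c0) => g; rewrite -lte_fin /= fineK//.
  by rewrite ge0_fin_numE ?ltW.
(* The exponent stays free: [s = 2 - e] serves logarithmic efficiency and [s = 2] bounded relative
   error. *)
have VM s : \forall g \near +oo%R, V g / (alpha P A g `^ s) <=
    (K s)%:E * (max_pair_prob P A g / (max_prob P A g `^ s)).
  apply: filterS alpha_small => g /(alphahat1_comparable hd (mA ^~ g))[VM _].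
  by apply: le_div_poweR => //; exact: variance_ge0.
have MV s : \forall g \near +oo%R,
    max_pair_prob P A g / (max_prob P A g `^ s) <=
    (K s)%:E * (V g / (alpha P A g `^ s)).
  apply: filterS alpha_small => g /(alphahat1_comparable hd (mA ^~ g))[_ MV].
  by apply: le_div_poweR => //; exact: max_pair_prob_ge0.
split.
  split=> H e e0; have := H e e0.
    apply: limsup_pinfty_eq0 (K0 _) _ (MV _) => g.
    by rewrite mule_ge0 ?inve_ge0 ?poweR_ge0//; exact: max_pair_prob_ge0.
  apply: limsup_pinfty_eq0 (K0 _) _ (VM _) => g.
  by rewrite mule_ge0 ?inve_ge0 ?poweR_ge0//; exact: variance_ge0.
rewrite /bounded_relative_error.
(* Squares become real powers, so that the dominations at [s = 2] apply. *)
under eq_fun do rewrite expe2_poweR ?ltW//.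
under [X in _ <-> limsup_pinfty X < _]eq_fun do rewrite expe2_poweR ?ltW//.
split; first exact: limsup_pinfty_lty (K0 _) (MV _).
exact: limsup_pinfty_lty (K0 _) (VM _).
Qed.
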